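(* Let $\lambda\in\mathbb{R}$ with $\lambda\neq 0$, let $X_1,X_2,\ldots$ be independent and identically distributed random variables with the skew-normal probability density function $f_\lambda(x)=2\phi(x)\Phi(\lambda x)$, $x\in\mathbb{R}$, and let $M_n=\max(X_1,\ldots,X_n)$. Define normalizing constants $b_n$ and $a_n$ as follows. If $\lambda>0$, let $b_n$ be the solution of $\sqrt{\pi/2}\,b_n\exp\left(\tfrac12 b_n^2\right)=n$ and $a_n=b_n^{-1}$. If $\lambda<0$, let $b_n>0$ be the solution of $\pi|\lambda|(1+\lambda^2)b_n^2\exp\left(\tfrac{(1+\lambda^2)b_n^2}{2}\right)=n$ and $a_n=(1+\lambda^2)^{-1}b_n^{-1}$. Then for every $x\in\mathbb{R}$, $$\mathbf{P}\left(M_n\le a_nx+b_n\right)\to\Lambda(x)\quad\text{as } n\to\infty,$$ where $\Lambda(x)=\exp(-\exp(-x))$.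
   Context: $\phi$ and $\Phi$ denote, respectively, the probability density function and the cumulative distribution function of the standard normal distribution. The standard skew-normal distribution with parameter $\lambda\in\mathbb{R}$ is the distribution on $\mathbb{R}$ with density $f_\lambda(x)=2\phi(x)\Phi(\lambda x)$. $\Lambda(x)=\exp(-\exp(-x))$, $x\in\mathbb{R}$, is the Gumbel extreme value distribution function. *)

(* Defs.v *)
From HB Require Import structures.
From mathcomp Require Import all_boot all_order all_algebra finmap.
From mathcomp Require Import all_classical all_reals all_analysis.

Set Implicit Arguments.
Unset Strict Implicit.
Unset Printing Implicit Defensive.

Import Order.TTheory GRing.Theory Num.Theory.
Import numFieldNormedType.Exports.

Local Open Scope classical_set_scope.
Local Open Scope ring_scope.

Definition std_normal_pdf (R : realType) (x : R) : R := normal_pdf 0 1 x.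

Definition std_normal_cdf (R : realType) (x : R) : R :=
  fine (normal_prob (0 : R) 1 `]-oo, x]).

Definition skew_normal_pdf (R : realType) (lam x : R) : R :=
  2 * std_normal_pdf x * std_normal_cdf (lam * x).

Definition gumbel_cdf (R : realType) (x : R) : R := expR (- expR (- x)).

Definition has_density (d : measure_display) (T : measurableType d)
    (R : realType) (P : probability T R) (X : {RV P >-> R}) (f : R -> R) : Prop :=
  forall A : set R, measurable A ->
    distribution P X A = (\int[lebesgue_measure]_(x in A) (f x)%:E)%E.

Definition mutually_independent (d : measure_display) (T : measurableType d)
    (R : realType) (P : probability T R) (X : nat -> {RV P >-> R}) : Prop :=
  forall (J : {fset nat}) (A : nat -> set R),
    (forall i, i \in J -> measurable (A i)) ->
    P (\bigcap_(i in [set` J]) (X i @^-1` A i)) =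
    (\prod_(i <- J) P (X i @^-1` A i))%E.

(* The family is indexed from 0, so this is the maximum of the first n
   variables; the default value X 0 only matters for n = 0. *)
Definition sample_max (d : measure_display) (T : measurableType d)
    (R : realType) (P : probability T R) (X : nat -> {RV P >-> R})
    (n : nat) (w : T) : R :=
  \big[Num.max/X 0%N w]_(i < n) X i w.

(* For lam > 0 and n > 0 the equation forces b > 0, and b is unique; for
   lam < 0 it is even in b, so positivity has to be required. *)
Definition is_location (R : realType) (lam : R) (n : nat) (b : R) : Prop :=
  if 0 < lam then
    Num.sqrt (pi / 2) * b * expR (b ^+ 2 / 2) = n%:R
  else
    0 < b /\
    pi * `|lam| * (1 + lam ^+ 2) * b ^+ 2 *
      expR ((1 + lam ^+ 2) * b ^+ 2 / 2) = n%:R.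

Definition scale_of_location (R : realType) (lam b : R) : R :=
  if 0 < lam then b^-1 else (1 + lam ^+ 2)^-1 * b^-1.

(* Main.v *)
(* Write g(t) = exp (- c t^2 / 2) / t^m with m >= 1. Since -g' = (c t + m / t) g, a
   density equivalent to K c t g(t) at infinity has a tail H equivalent to K g.
   For lam > 0 the skew-normal density is such (K c = 2 phi(0), c = m = 1) because
   Phi(lam t) tends to 1; for lam < 0 it is such with c = 1 + lam^2 and m = 2 by
   Mills' ratio for Phi(lam t). The equation defining b_n reads n K g(b_n) = 1, and
   g(b_n + x / (c b_n)) / g(b_n) tends to exp(-x) because b_n tends to infinity; hence
   n H(a_n x + b_n) tends to exp(-x) and (1 - H(a_n x + b_n))^n to Lambda(x). *)
Require Import Defs.
From mathcomp Require Import all_boot all_order all_algebra.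
From mathcomp Require Import finmap.
From mathcomp Require Import all_classical all_reals all_analysis.
From mathcomp Require Import measurable_realfun ring lra.
Import Order.TTheory GRing.Theory Num.Theory.
Import numFieldNormedType.Exports.
Local Open Scope classical_set_scope.
Local Open Scope ring_scope.

(** * The Gaussian kernel: monotonicity, derivative, decay and exact integration *)

Section gauss_kernel.
Context {R : realType}.
Implicit Types (c x t : R) (m : nat).

(** This is the function [g] of the overview; at [c = m = 1], [phi(0) * g(x)] is [phi(x) / x],
    Mills' approximation to the normal tail. *)
Definition gauss_kernel c m x : R := expR (- (c / 2 * x ^+ 2)) / x ^+ m.

Lemma gauss_kernel_gt0 c m x : 0 < x -> 0 < gauss_kernel c m x.
Proof. by move=> x0; rewrite divr_gt0 ?expR_gt0 ?exprn_gt0. Qed.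

Lemma gauss_kernel_le c m x y : 0 < c -> 0 < x -> x <= y ->
  gauss_kernel c m y <= gauss_kernel c m x.
Proof.
move=> c0 x0 xy; have y0 : 0 < y by lra.
apply: ler_pM; [exact: expR_ge0|by rewrite invr_ge0 exprn_ge0// ltW| |].
  rewrite ler_expR lerN2; apply: ler_wpM2l; first by rewrite divr_ge0// ltW.
  by rewrite lerXn2r// nnegrE ltW.
by rewrite lef_pV2 ?posrE ?exprn_gt0// lerXn2r// nnegrE ltW.
Qed.

Lemma is_derive_exprn m x :
  is_derive x 1 (fun y : R => y ^+ m) (m%:R * x ^+ m.-1).
Proof.
rewrite (_ : (fun y => y ^+ m) = id ^+ m); last first.
  by apply/funext => y; rewrite exprfctE.
by apply: is_derive_eq; rewrite /GRing.scale/= mulr1.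
Qed.

Lemma is_derive_gauss_kernel c m x : 0 < x ->
  is_derive x 1 (gauss_kernel c m) (- ((c * x + m%:R / x) * gauss_kernel c m x)).
Proof.
move=> x0; have xm0 : x ^+ m != 0 by rewrite expf_neq0// gt_eqF.
have x_neq0 : x != 0 by rewrite gt_eqF.
have dV : is_derive x 1 (fun y : R => (y ^+ m)^-1) (- (m%:R / x) / x ^+ m).
  have dX := is_derive_exprn m x.
  apply: (is_derive_eq (@is_deriveV _ (fun y => y ^+ m) _ _ _ xm0 dX)).
  rewrite /GRing.scale/=.
  (* The exponent [m.-1] is a truncated predecessor: at [m = 0] the coefficient vanishes, and
     otherwise a power of [x] cancels. *)
  case: m xm0 {dX} => [|m] xm0; first by rewrite !mul0r mulr0 oppr0 mul0r.
  have xm1 : x ^+ m != 0 by rewrite expf_neq0.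
  by rewrite /= (exprS x m); field; rewrite xm1 x_neq0.
have dE : is_derive x 1 (fun y : R => expR (- (c / 2 * y ^+ 2)))
    (expR (- (c / 2 * x ^+ 2)) * (- (c * x))).
  apply: (@is_derive1_comp _ expR (fun y => - (c / 2 * y ^+ 2))).
  have dX := is_derive_exprn 2 x.
  by apply: is_derive_eq; rewrite /GRing.scale/=; field.
apply: is_derive_eq; rewrite /GRing.scale/= /gauss_kernel; field.
by rewrite xm0 x_neq0.
Qed.

Lemma continuous_gauss_kernel c m x : 0 < x ->
  {for x, continuous (gauss_kernel c m)}.
Proof.
move=> x0; have [dE _] := is_derive_gauss_kernel c m x x0.
exact/differentiable_continuous/derivable1_diffP.
Qed.

(** For [x >= 1] the exponential is at most 1 and [x ^ (m + 1) >= x], so the kernel lies between 0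
    and [1 / x]. *)
Lemma gauss_kernel_cvgy c m : 0 < c -> gauss_kernel c m.+1 x @[x --> +oo] --> 0.
Proof.
move=> c0; apply: (@squeeze_cvgr _ _ _ _ (fun=> 0) (fun x => x^-1)); last 2 first.
- exact: cvg_cst.
- by apply/gtr0_cvgV0; [exact: nbhs_pinfty_gt|exact: cvg_id].
near=> x; have x1 : 1 <= x by near: x; exact: nbhs_pinfty_ge.
have x0 : 0 < x by lra.
rewrite ltW ?gauss_kernel_gt0//= -[leRHS]mul1r; apply: ler_pM.
- exact: expR_ge0.
- by rewrite invr_ge0 exprn_ge0// ltW.
- rewrite -[leRHS]expR0 ler_expR oppr_le0.
  by apply: mulr_ge0; [rewrite divr_ge0// ltW|exact: sqr_ge0].
- rewrite lef_pV2 ?posrE ?exprn_gt0// exprS.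
  by apply: ler_peMr; [exact: ltW|exact: exprn_ege1].
Unshelve. all: by end_near. Qed.

Lemma continuous_gauss_kernel_derive (K : R) c m x : 0 < x ->
  {for x, continuous (fun y => K * ((c * y + m%:R / y) * gauss_kernel c m y))}.
Proof.
move=> x0; apply: cvgM; first exact: cvg_cst.
apply: cvgM; last exact: continuous_gauss_kernel.
apply: cvgD; first by apply: cvgM; [exact: cvg_cst|exact: cvg_id].
by apply: cvgM; [exact: cvg_cst|apply: cvgV; [rewrite gt_eqF|exact: cvg_id]].
Qed.

Lemma measurable_gauss_kernel_derive (K : R) c m t : 0 < t ->
  measurable_fun `]t, +oo[
    (fun x : R => (K * ((c * x + m%:R / x) * gauss_kernel c m x))%:E).
Proof.
move=> t0; apply/measurable_EFinP; apply: open_continuous_measurable_fun => //.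
move=> x; rewrite inE/= in_itv/= andbT => tx.
exact: continuous_gauss_kernel_derive (lt_trans t0 tx).
Qed.

(* The correction [m.+1 / x], negligible against [c * x], makes the integral exact. *)
Lemma integral_gauss_kernel (K : R) c m t : 0 <= K -> 0 < c -> 0 < t ->
  (\int[lebesgue_measure]_(x in `]t, +oo[)
     (K * ((c * x + m.+1%:R / x) * gauss_kernel c m.+1 x))%:E =
   (K * gauss_kernel c m.+1 t)%:E)%E.
Proof.
move=> K0 c0 t0.
set f := fun x => K * ((c * x + m.+1%:R / x) * gauss_kernel c m.+1 x).
have f_cont x : 0 < x -> {for x, continuous f}.
  exact: continuous_gauss_kernel_derive.
have f_within : {within `[t, +oo[, continuous f}.
  apply/continuous_within_itvcyP; split.
    by move=> x; rewrite in_itv/= andbT => tx; apply: f_cont; lra.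
  by apply: cvg_at_right_filter; exact: f_cont.
have dF x : 0 < x -> is_derive x 1 (fun y => - (K * gauss_kernel c m.+1 y)) (f x).
  move=> x0; have := is_derive_gauss_kernel c m.+1 x x0 => D.
  by apply: is_derive_eq; rewrite /GRing.scale/= /f; ring.
rewrite integral_itv_obnd_cbnd; last exact: measurable_gauss_kernel_derive.
(* A primitive of [f] that vanishes at infinity, so the integral over the half-line is [0 - F t]. *)
pose F x := - (K * gauss_kernel c m.+1 x).
have f_ge0 x : t <= x -> 0 <= f x.
  move=> tx; have x0 : 0 < x by lra.
  apply: mulr_ge0 => //; apply: mulr_ge0; last by rewrite ltW ?gauss_kernel_gt0.
  by apply: addr_ge0; [apply: mulr_ge0; exact: ltW|apply: divr_ge0; rewrite ?ler0n ?ltW].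
have F_cvgy : F x @[x --> +oo] --> 0.
  rewrite -oppr0; apply: cvgN; rewrite -(mulr0 K).
  by apply: cvgM; [exact: cvg_cst|exact: gauss_kernel_cvgy].
have F_derivable x : t < x -> derivable F x 1.
  by move=> tx; have [] := dF x (lt_trans t0 tx).
have F_cvgt : F x @[x --> t^'+] --> F t.
  apply: cvg_at_right_filter; apply: cvgN; apply: cvgM; first exact: cvg_cst.
  exact: continuous_gauss_kernel.
have F'E : {in `]t, +oo[, F^`()%classic =1 f}.
  move=> x; rewrite in_itv/= andbT => tx; rewrite derive1E.
  by have D := dF x (lt_trans t0 tx); rewrite derive_val.
have -> := ge0_continuous_FTC2y f_ge0 f_within F_cvgy F_derivable F_cvgt F'E.
by rewrite sub0e -EFinN opprK.
Qed.

End gauss_kernel.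

(** * Tail integrals of densities comparable to a Gaussian kernel *)

Section gauss_tail.
Context {R : realType} (K c : R) (m : nat).
Hypotheses (K_gt0 : 0 < K) (c_gt0 : 0 < c).
Local Notation g := (gauss_kernel c m.+1).

(** Up to the factor [1 + (m + 1) / (c x^2)], [c x g(x)] is [- g'(x)]. For [x > t] this factor lies
    between 1 and its value at [t], so [f] is squeezed between constant multiples of [- K g'], which
    integrate exactly. *)
Lemma gauss_tail_bounds (f : R -> R) (r t : R) : 0 < t -> 0 <= r ->
  measurable_fun `]t, +oo[ f ->
  (forall x, t < x -> r * (K * (c * x * g x)) <= f x <= K * (c * x * g x)) ->
  ((r / (1 + m.+1%:R / c / t ^+ 2) * (K * g t))%:E <=
     \int[lebesgue_measure]_(x in `]t, +oo[) (f x)%:E <= (K * g t)%:E)%E.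
Proof.
move=> t0 r0 mf fB.
have mg := measurable_gauss_kernel_derive.
have mfE : measurable_fun `]t, +oo[ (EFin \o f) by exact/measurable_EFinP.
have inD x : (`]t, +oo[%classic : set R) x -> t < x.
  by rewrite /= in_itv/= andbT.
have q_gt0 x : 0 < x -> 0 < m.+1%:R / c / x ^+ 2.
  by move=> x0; rewrite divr_gt0 ?exprn_gt0// divr_gt0.
have wE x : 0 < x ->
    (c * x + m.+1%:R / x) * g x = c * x * g x * (1 + m.+1%:R / c / x ^+ 2).
  by move=> x0; field; rewrite !gt_eqF.
have gx0 x : 0 < x -> 0 < c * x * g x.
  by move=> x0; rewrite mulr_gt0 ?gauss_kernel_gt0 ?mulr_gt0.
have f_ge0 x : t < x -> 0 <= f x.
  move=> tx; have x0 : 0 < x by lra.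
  have /andP[+ _] := fB x tx; apply: le_trans.
  by apply: mulr_ge0 => //; apply: mulr_ge0; apply: ltW => //; exact: gx0.
apply/andP; split.
- rewrite mulrA -integral_gauss_kernel//; last first.
    by rewrite mulr_ge0 ?divr_ge0 ?addr_ge0// ?ltW// q_gt0.
  apply: ge0_le_integral => //.
  + move=> x /inD tx; have x0 : 0 < x by lra.
    rewrite lee_fin wE//; apply: mulr_ge0.
      by rewrite mulr_ge0 ?divr_ge0 ?addr_ge0// ?ltW// q_gt0.
    by apply: mulr_ge0; [exact/ltW/gx0|rewrite addr_ge0// ltW// q_gt0].
  + exact: mg.
  + move=> x /inD tx; have x0 : 0 < x by lra.
    rewrite lee_fin; have /andP[+ _] := fB x tx; apply: le_trans.
    (* [u] and [v] are the correction factor at [x] and at [t]; it decreases, so [u / v <= 1]. *)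
    rewrite wE//; set u := 1 + _ / x ^+ 2; set v := 1 + _ / t ^+ 2.
    have -> : r / v * K * (c * x * g x * u) = r * (K * (c * x * g x)) * (u / v).
      by ring.
    apply: ler_piMr.
      by apply: mulr_ge0 => //; apply: mulr_ge0; apply: ltW => //; exact: gx0.
    rewrite ler_pdivrMr ?mul1r /v ?addr_gt0 ?q_gt0// /u.
    rewrite lerD2l; apply: ler_wpM2l; first by rewrite divr_ge0 ?ltW.
    rewrite lef_pV2 ?posrE ?exprn_gt0//.
    by rewrite lerXn2r ?nnegrE ?ltW.
- rewrite -integral_gauss_kernel//; last exact: ltW.
  apply: ge0_le_integral => //.
  + by move=> x /inD tx; rewrite lee_fin f_ge0.
  + exact: mg.
  + move=> x /inD tx; have x0 : 0 < x by lra.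
    rewrite lee_fin; have /andP[_] := fB x tx; move/le_trans; apply.
    rewrite wE//; apply: ler_wpM2l; first exact: ltW.
    apply: ler_peMr; first exact/ltW/gx0.
    by rewrite lerDl ltW// q_gt0.
Qed.

(** The ratio [r] is taken at the left end [t] and not at [x]: it is then a constant under the
    integral, and both tail bounds divided by [K g(t)] tend to 1. *)
Lemma gauss_tail_equiv (f H r : R -> R) :
  measurable_fun setT f ->
  (forall t, 0 < t ->
    (\int[lebesgue_measure]_(x in `]t, +oo[) (f x)%:E = (H t)%:E)%E) ->
  (forall t, 0 < t -> 0 <= r t) -> r t @[t --> +oo] --> (1 : R) ->
  (forall t x, 0 < t -> t < x ->
    r t * (K * (c * x * g x)) <= f x <= K * (c * x * g x)) ->
  H t / (K * g t) @[t --> +oo] --> (1 : R).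
Proof.
move=> mf fH r_ge0 r1 fB.
apply: (@squeeze_cvgr _ _ _ _ (fun t => r t / (1 + m.+1%:R / c / t ^+ 2)) (fun=> 1)).
- near=> t; have t0 : 0 < t by near: t; exact: nbhs_pinfty_gt.
  have := gauss_tail_bounds f (r t) t t0 (r_ge0 t t0)
    (measurable_funS measurableT (@subsetT _ _) mf) (fun x => fB t x t0).
  have Kg0 : 0 < K * g t by rewrite mulr_gt0 ?gauss_kernel_gt0.
  rewrite fH// !lee_fin => /andP[lo hi]; apply/andP; split.
    by rewrite ler_pdivlMr.
  by rewrite ler_pdivrMr// mul1r.
- rewrite -[X in _ --> X]divr1; apply: cvgM => //; apply: cvgV; first exact: oner_neq0.
  rewrite -[X in _ --> X]addr0; apply: cvgD; first exact: cvg_cst.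
  rewrite -(mulr0 (m.+1%:R / c)); apply: cvgM; first exact: cvg_cst.
  apply/gtr0_cvgV0; last exact: cvgr_expr2.
  near=> t; have t0 : 0 < t by near: t; exact: nbhs_pinfty_gt.
  by rewrite exprn_gt0.
- exact: cvg_cst.
Unshelve. all: by end_near. Qed.

End gauss_tail.

(** * Limits of n-th powers, and the tail at the normalized level *)

Section extremal_limit.
Context {R : realType}.

Lemma cvg_onem_exprn (u : nat -> R) (L : R) :
  n%:R * u n @[n --> \oo] --> L ->
  (1 - u n) ^+ n @[n --> \oo] --> expR (- L).
Proof.
(* Squeeze using [exp (- u / (1 - u)) <= 1 - u <= exp (- u)]. *)
move=> uL.
have u0 : u n @[n --> \oo] --> (0 : R).
  have : n%:R^-1 * (n%:R * u n) @[n --> \oo] --> 0 * L.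
    apply: cvgM uL; apply/gtr0_cvgV0; last exact: cvgr_idn.
    by near=> n; rewrite ltr0n; near: n; exact: nbhs_infty_gt.
  rewrite mul0r; apply: cvg_trans; apply: near_eq_cvg; near=> n.
  rewrite mulKf// pnatr_eq0 -lt0n; near: n; exact: nbhs_infty_gt.
apply: (@squeeze_cvgr _ _ _ _ (fun n => expR (- (n%:R * u n / (1 - u n))))
  (fun n => expR (- (n%:R * u n)))).
- near=> n; have u1 : u n < 1 by near: n; exact: (cvgr_lt (0 : R)).
  have v0 : 0 < 1 - u n by rewrite subr_gt0.
  rewrite -(mulrA n%:R) -(mulrN n%:R (u n)) -(mulrN n%:R) !expRM_natl; apply/andP; split.
    apply: lerXn2r; [by rewrite nnegrE expR_ge0|by rewrite nnegrE ltW|].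
    (* After inversion the lower bound reads [1 / (1 - u) = 1 + u / (1 - u) <= exp (u / (1 -
       u))]. *)
    rewrite expRN invf_ple ?posrE ?expR_gt0//.
    apply: le_trans (expR_ge1Dx _).
    by rewrite le_eqVlt; apply/orP; left; apply/eqP; field; rewrite gt_eqF.
  apply: lerXn2r; [by rewrite nnegrE ltW|by rewrite nnegrE expR_ge0|].
  exact: expR_ge1Dx.
- apply: (cvg_comp _ (@expR R)); last exact: continuous_expR.
  apply: cvgN; rewrite -[X in _ --> X]mulr1; apply: cvgM => //.
  rewrite -[X in _ --> X]invr1; apply: cvgV; first exact: oner_neq0.
  by rewrite -[X in _ --> X]subr0; apply: cvgB => //; exact: cvg_cst.
- apply: (cvg_comp _ (@expR R)); last exact: continuous_expR.
  by apply: cvgN; exact: uL.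
Unshelve. all: by end_near. Qed.

Context (K c : R) (m : nat) (b : nat -> R).
Hypotheses (K_gt0 : 0 < K) (c_gt0 : 0 < c).
Local Notation g := (gauss_kernel c m.+1).
(** Index 0 is excluded here and below because the location equation would read [0 = 1] there. *)
Hypothesis b_gt0 : forall n, (0 < n)%N -> 0 < b n.
Hypothesis b_loc : forall n, (0 < n)%N -> n%:R * (K * g (b n)) = 1.

(** If [b n] stayed below a positive level [A'], monotonicity of [g] would give
    [K g(A') <= K g(b n) = 1 / n], which fails for large [n]. *)
Lemma location_cvgy : b n @[n --> \oo] --> +oo.
Proof.
(* The maximum with 1 makes the level positive, where the kernel is known to decrease. *)
apply/cvgryPge => A; pose A' := Num.max A 1.
have A'0 : 0 < A' by rewrite /A' lt_max ltr01 orbT.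
have KgA : 0 < K * g A' by rewrite mulr_gt0 ?gauss_kernel_gt0.
near=> n; have n0 : (0 < n)%N by near: n; exact: nbhs_infty_gt.
have : (K * g A')^-1 < n%:R by near: n; exact: nbhs_infty_gtr.
apply: contraPT; rewrite -ltNge => bA; apply/negP; rewrite -leNgt.
rewrite -[leRHS]mul1r ler_pdivlMr// -[leRHS](b_loc n n0); apply: ler_wpM2l => //.
apply: ler_wpM2l; first exact: ltW.
apply: gauss_kernel_le => //; first exact: b_gt0.
by rewrite /A' le_max ltW.
Unshelve. all: by end_near. Qed.

(** As soon as [b n >= 1], the shift [x / (c b n)] is at least [- |x| / c], a constant. *)
Lemma shifted_location_cvgy (x : R) :
  (c * b n)^-1 * x + b n @[n --> \oo] --> +oo.
Proof.
apply: (@ger_cvgy _ _ _ _ (fun n => - (`|x| / c) + b n)).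
  near=> n; rewrite lerD2r lerNl.
  have b1 : 1 <= b n.
    by near: n; move/cvgryPge : location_cvgy; exact.
  have b0 : 0 < b n by lra.
  have -> : - ((c * b n)^-1 * x) = - x / c / b n by field; rewrite !gt_eqF.
  apply: (@le_trans _ _ (`|x| / c / b n)).
    apply: ler_wpM2r; first by rewrite invr_ge0 ltW.
    apply: ler_wpM2r; first by rewrite invr_ge0 ltW.
    by rewrite -normrN ler_norm.
  rewrite ler_pdivrMr//; apply: ler_peMr => //.
  by rewrite divr_ge0// ltW.
apply/cvgryPge => A; near=> n; rewrite -lerBlDl.
near: n; move/cvgryPge : location_cvgy; exact.
Unshelve. all: by end_near. Qed.

(* Everything beyond [exp (- x)] depends on [y] only through [1 / y ^ 2]. *)
Lemma gauss_kernel_shift (x y : R) : 0 < y ->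
  g ((c * y)^-1 * x + y) = g y * (expR (- x - x ^+ 2 / (2 * c) * (y ^+ 2)^-1) /
    (1 + x / c * (y ^+ 2)^-1) ^+ m.+1).
Proof.
move=> y0; rewrite /gauss_kernel.
have y_neq0 : y != 0 by rewrite gt_eqF.
have c_neq0 : c != 0 by rewrite gt_eqF.
have -> : (c * y)^-1 * x + y = y * (1 + x / c * (y ^+ 2)^-1).
  by field; rewrite y_neq0.
rewrite (exprMn m.+1) (invfM (y ^+ m.+1)) [RHS]mulrACA -expRD; congr (expR _ * _); field.
by rewrite y_neq0.
Qed.

(** With [t n] the shifted location, [n H(t n)] is the product of [H(t n) / (K g(t n))], which tends
    to 1, and [n K g(t n)], which equals [g(t n) / g(b n)] by the location equation. *)
Lemma tail_location_cvg (H : R -> R) (x : R) :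
  H t / (K * g t) @[t --> +oo] --> (1 : R) ->
  n%:R * H ((c * b n)^-1 * x + b n) @[n --> \oo] --> expR (- x).
Proof.
move=> Hg; pose t n := (c * b n)^-1 * x + b n.
have v0 : (b n ^+ 2)^-1 @[n --> \oo] --> (0 : R).
  apply/gtr0_cvgV0.
    by near=> n; rewrite exprn_gt0// b_gt0//; near: n; exact: nbhs_infty_gt.
  exact: (cvg_comp _ _ location_cvgy cvgr_expr2).
(* For [n > 0] this is the quotient [g(t n) / g(b n)], in the form given by [gauss_kernel_shift]. *)
pose s n := expR (- x - x ^+ 2 / (2 * c) * (b n ^+ 2)^-1) /
    (1 + x / c * (b n ^+ 2)^-1) ^+ m.+1.
have num_cvg : - x - x ^+ 2 / (2 * c) * (b n ^+ 2)^-1 @[n --> \oo] --> - x.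
  rewrite -[X in _ --> X]subr0; apply: cvgB; first exact: cvg_cst.
  by rewrite -(mulr0 (x ^+ 2 / (2 * c))); apply: cvgM => //; exact: cvg_cst.
have den_cvg : 1 + x / c * (b n ^+ 2)^-1 @[n --> \oo] --> (1 : R).
  rewrite -[X in _ --> X]addr0; apply: cvgD; first exact: cvg_cst.
  by rewrite -(mulr0 (x / c)); apply: cvgM => //; exact: cvg_cst.
have s_cvg : s n @[n --> \oo] --> expR (- x).
  rewrite -[X in _ --> X]divr1; apply: cvgM.
    by apply: (cvg_comp _ _ num_cvg); exact: continuous_expR.
  apply: cvgV; first exact: oner_neq0.
  rewrite -[X in _ --> X](expr1n R m.+1).
  by apply: (cvg_comp _ (fun y : R => y ^+ m.+1) den_cvg); exact: exprn_continuous.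
have Hs : H (t n) / (K * g (t n)) * s n @[n --> \oo] --> expR (- x).
  rewrite -[X in _ --> X]mul1r; apply: cvgM => //.
  exact: (cvg_comp _ _ (shifted_location_cvgy x) Hg).
apply: cvg_trans Hs; apply: near_eq_cvg; near=> n.
have n0 : (0 < n)%N by near: n; exact: nbhs_infty_gt.
have t0 : 0 < t n.
  by near: n; move/cvgryPgt : (shifted_location_cvgy x); exact.
have gb := gauss_kernel_shift x (b n) (b_gt0 n n0).
have Kgt : K * g (t n) = n%:R^-1 * s n.
  rewrite gb mulrA; congr (_ * _).
  by rewrite -[RHS]mulr1 -[X in _ = _ * X](b_loc n n0) mulKf// pnatr_eq0 -lt0n.
have Kgt_neq0 : K * g (t n) != 0 by rewrite gt_eqF// mulr_gt0 ?gauss_kernel_gt0.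
have sE : s n = n%:R * (K * g (t n)) by rewrite Kgt mulVKf// pnatr_eq0 -lt0n.
by rewrite sE [n%:R * _]mulrC mulrA divfK// mulrC.
Unshelve. all: by end_near. Qed.

End extremal_limit.

(** * Mills' ratio and the skew-normal tail for each sign of [lam] *)

Section skew_normal_tail.
Context {R : realType}.
Local Notation peak := (normal_peak (1 : R)).
Implicit Types (x s t lam : R).

Lemma std_normal_pdfE x : std_normal_pdf x = peak * expR (- (1 / 2 * x ^+ 2)).
Proof.
rewrite /std_normal_pdf normal_pdfE ?oner_neq0// /normal_fun; congr (_ * expR _).
by rewrite subr0 expr1n mulNr mulrC mul1r.
Qed.

(** Puts [phi] in the shape [K * (c * x * g x)] that the tail bounds expect, with [c = 1] and
    exponent 1. *)
Lemma std_normal_pdf_gauss_kernel x : 0 < x ->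
  std_normal_pdf x = peak * (1 * x * gauss_kernel 1 1 x).
Proof.
move=> x0; rewrite std_normal_pdfE /gauss_kernel expr1; congr (_ * _).
by field; rewrite gt_eqF.
Qed.

Lemma peak_gt0 : 0 < peak.
Proof. by rewrite normal_peak_gt0// oner_neq0. Qed.

Lemma peak_sqr : 2 * pi * peak ^+ 2 = 1.
Proof.
have pi0 := pi_gt0 R.
rewrite /normal_peak expr1n mul1r exprVn sqr_sqrtr; last by rewrite mulrn_wge0// ltW.
by rewrite mulr_natl mulfV// gt_eqF// mulrn_wgt0.
Qed.

(** Identifies the constant in the location equation for [lam > 0] as the inverse of
    [K = 2 phi(0)]. *)
Lemma sqrt_pi_half_peak : Num.sqrt (pi / 2) * (2 * peak) = 1.
Proof.
have pi0 := pi_gt0 R; have p0 := peak_gt0.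
have s0 := sqrtr_ge0 (pi / 2 : R).
apply/eqP; rewrite -(@eqrXn2 _ 2)//; last by rewrite mulr_ge0// mulr_ge0// ltW.
rewrite exprMn sqr_sqrtr; last by rewrite divr_ge0// ltW.
rewrite expr1n -[X in _ == X]peak_sqr; by apply/eqP; field.
Qed.

Lemma measurable_std_normal_pdf : measurable_fun setT (@std_normal_pdf R).
Proof. exact: measurable_normal_pdf. Qed.

(** Mills' inequalities [t phi(t) / (1 + t^2) <= 1 - Phi(t) <= phi(t) / t]: [phi] has exactly the
    required shape, so the tail bounds apply with [r = 1]. *)
Lemma std_normal_upper_tail t : 0 < t ->
  ((1 / (1 + 1 / 1 / t ^+ 2) * (peak * gauss_kernel 1 1 t))%:E <=
    normal_prob (0 : R) 1 `]t, +oo[ <= (peak * gauss_kernel 1 1 t)%:E)%E.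
Proof.
move=> t0.
have mpdf : measurable_fun `]t, +oo[ (@std_normal_pdf R).
  exact: (measurable_funS measurableT (@subsetT _ _) measurable_std_normal_pdf).
apply: (gauss_tail_bounds _ _ 0 peak_gt0 ltr01 _ _ _ t0 ler01 mpdf) => x tx.
have x0 : 0 < x by exact: lt_trans tx.
by rewrite -std_normal_pdf_gauss_kernel// mul1r lexx.
Qed.

Lemma std_normal_cdfE x : (std_normal_cdf x)%:E = normal_prob (0 : R) 1 `]-oo, x].
Proof. by rewrite /std_normal_cdf fineK// fin_num_measure. Qed.

Lemma std_normal_cdf_ge0 x : 0 <= std_normal_cdf x.
Proof. by rewrite -lee_fin std_normal_cdfE measure_ge0. Qed.

Lemma std_normal_cdf_le1 x : std_normal_cdf x <= 1.
Proof. by rewrite -lee_fin std_normal_cdfE probability_le1. Qed.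

Lemma std_normal_cdf_nondecreasing : {homo @std_normal_cdf R : x y / x <= y}.
Proof.
move=> x y xy; rewrite -lee_fin !std_normal_cdfE le_measure ?inE//.
by apply: subset_itvl; rewrite bnd_simp.
Qed.

Lemma std_normal_cdf_ge s : 0 < s ->
  1 - peak * gauss_kernel 1 1 s <= std_normal_cdf s.
Proof.
move=> s0; have /andP[_ hi] := std_normal_upper_tail s s0.
rewrite -lee_fin std_normal_cdfE -[X in normal_prob _ _ X]setCK setCitvl.
rewrite probability_setC// EFinB; exact: leeB.
Qed.

(** Substitution [x -> - x] and evenness of [phi]; this carries Mills' inequalities over to [Phi] at
    negative arguments. *)
Lemma std_normal_cdfN s :
  (std_normal_cdf (- s))%:E = normal_prob (0 : R) 1 `]s, +oo[.
Proof.
have cpdf : continuous (@std_normal_pdf R).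
  by apply: continuous_normal_pdf; exact: oner_neq0.
rewrite std_normal_cdfE /normal_prob.
rewrite ge0_integration_by_substitutionNy; last 2 first.
- exact: continuous_subspaceT.
- by move=> x _; exact: normal_pdf_ge0.
rewrite [RHS]integral_itv_obnd_cbnd; last first.
  by apply/measurable_EFinP; apply: (measurable_funS measurableT (@subsetT _ _));
     exact: measurable_normal_pdf.
apply: eq_integral => x _ /=; congr EFin.
by rewrite -/(std_normal_pdf (- x)) -/(std_normal_pdf x) !std_normal_pdfE sqrrN.
Qed.

Lemma std_normal_cdf_cvg1 lam : 0 < lam ->
  std_normal_cdf (lam * t) @[t --> +oo] --> (1 : R).
Proof.
move=> lam0.
apply: (@squeeze_cvgr _ _ _ _ (fun t => 1 - peak * gauss_kernel 1 1 (lam * t)) (fun=> 1)).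
- near=> t; rewrite std_normal_cdf_le1 andbT; apply: std_normal_cdf_ge.
  rewrite mulr_gt0//; near: t; exact: nbhs_pinfty_gt.
- rewrite -[X in _ --> X]subr0; apply: cvgB; first exact: cvg_cst.
  rewrite -(mulr0 peak); apply: cvgM; first exact: cvg_cst.
  have lamy : lam * t @[t --> +oo] --> +oo by apply: gt0_cvgMry => //; exact: cvg_id.
  exact: (cvg_comp _ _ lamy (gauss_kernel_cvgy 1 0 ltr01)).
- exact: cvg_cst.
Unshelve. all: by end_near. Qed.

Lemma measurable_skew_normal_pdf lam : measurable_fun setT (skew_normal_pdf lam).
Proof.
apply: measurable_funM.
  by apply: measurable_funM => //; exact: measurable_std_normal_pdf.
apply: (measurableT_comp (f := @std_normal_cdf R)).
  by apply: nondecreasing_measurable => //; exact: std_normal_cdf_nondecreasing.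
exact: measurable_funM.
Qed.

(** For [x > t] one has [Phi(lam t) <= Phi(lam x) <= 1], so [r t = Phi(lam t)] serves as the lower
    ratio. *)
Lemma skew_normal_tail_pos lam (H : R -> R) : 0 < lam ->
  (forall t, 0 < t -> (\int[lebesgue_measure]_(x in `]t, +oo[)
    (skew_normal_pdf lam x)%:E = (H t)%:E)%E) ->
  H t / (2 * peak * gauss_kernel 1 1 t) @[t --> +oo] --> (1 : R).
Proof.
move=> lam0 fH.
apply: (gauss_tail_equiv (2 * peak) 1 0 _ ltr01 (skew_normal_pdf lam) H
  (fun t => std_normal_cdf (lam * t))) => //.
- by rewrite mulr_gt0// peak_gt0.
- exact: measurable_skew_normal_pdf.
- by move=> t _; exact: std_normal_cdf_ge0.
- exact: std_normal_cdf_cvg1.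
- move=> t x t0 tx; have x0 : 0 < x by exact: lt_trans tx.
  rewrite -(mulrA 2 peak) -std_normal_pdf_gauss_kernel// /skew_normal_pdf.
  have phi0 : 0 <= 2 * std_normal_pdf x.
    by apply: mulr_ge0 => //; exact: normal_pdf_ge0.
  apply/andP; split.
    rewrite mulrC; apply: ler_wpM2l => //; apply: std_normal_cdf_nondecreasing.
    by rewrite ler_pM2l// ltW.
  by apply: ler_piMr => //; exact: std_normal_cdf_le1.
Qed.

(** By Mills' ratio the density is equivalent to [exp (- c x^2 / 2) / (pi |lam| x)] with
    [c = 1 + lam^2]. Written as [K c x g(x)], this forces exponent 2 and [K c = 1 / (pi |lam|)]. *)
Lemma skew_normal_tail_neg lam (H : R -> R) : lam < 0 ->
  (forall t, 0 < t -> (\int[lebesgue_measure]_(x in `]t, +oo[)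
    (skew_normal_pdf lam x)%:E = (H t)%:E)%E) ->
  H t / ((pi * `|lam| * (1 + lam ^+ 2))^-1 * gauss_kernel (1 + lam ^+ 2) 2 t)
    @[t --> +oo] --> (1 : R).
Proof.
move=> lam0 fH; have pi0 := pi_gt0 R.
have mu0 : 0 < `|lam| by rewrite normr_gt0 lt_eqF.
have c0 : 0 < 1 + lam ^+ 2 by rewrite ltr_wpDr// sqr_ge0.
have K0 : 0 < (pi * `|lam| * (1 + lam ^+ 2))^-1 by rewrite invr_gt0 !mulr_gt0.
(* The lower Mills factor at [|lam| t], which increases with [t]. *)
pose r t := 1 / (1 + 1 / 1 / (`|lam| * t) ^+ 2).
apply: (gauss_tail_equiv _ _ 1 K0 c0 (skew_normal_pdf lam) H r) => //.
- exact: measurable_skew_normal_pdf.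
- by move=> t t0; rewrite divr_ge0// addr_ge0// divr_ge0// sqr_ge0.
- rewrite /r -[X in _ --> X]divr1; apply: cvgM; first exact: cvg_cst.
  apply: cvgV; first exact: oner_neq0.
  rewrite -[X in _ --> X]addr0; apply: cvgD; first exact: cvg_cst.
  rewrite -(mulr0 (1 / 1 : R)); apply: cvgM; first exact: cvg_cst.
  have muy : `|lam| * t @[t --> +oo] --> +oo.
    by apply: gt0_cvgMry => //; exact: cvg_id.
  apply/gtr0_cvgV0; last exact: (cvg_comp _ _ muy cvgr_expr2).
  near=> t; have t0 : 0 < t by near: t; exact: nbhs_pinfty_gt.
  by rewrite exprn_gt0// mulr_gt0.
- move=> t x t0 tx; have x0 : 0 < x by exact: lt_trans tx.
  set q := _ * (_ * gauss_kernel _ _ _).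
  have q0 : 0 <= q.
    apply: mulr_ge0; [exact: ltW|apply: mulr_ge0; apply: ltW].
      by rewrite mulr_gt0.
    exact: gauss_kernel_gt0.
  have phi0 : 0 <= 2 * std_normal_pdf x.
    by apply: mulr_ge0 => //; exact: normal_pdf_ge0.
  (* Since [phi x * phi (lam * x)] is proportional to [exp (- (1 + lam ^ 2) x ^ 2 / 2)],
     Mills' bound on [Phi (- |lam| x)] turns the density into a Gaussian kernel. *)
  have qE : q = 2 * std_normal_pdf x * (peak * gauss_kernel 1 1 (`|lam| * x)).
    rewrite std_normal_pdfE /q /gauss_kernel expr1.
    have -> : expR (- ((1 + lam ^+ 2) / 2 * x ^+ 2)) =
        expR (- (1 / 2 * x ^+ 2)) * expR (- (1 / 2 * (`|lam| * x) ^+ 2)).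
      by rewrite -expRD exprMn real_normK ?num_real//; congr expR; field.
    have -> : (pi * `|lam| * (1 + lam ^+ 2))^-1 =
        2 * peak ^+ 2 / (`|lam| * (1 + lam ^+ 2)).
      have -> : 2 * peak ^+ 2 = pi^-1.
        by apply: (mulfI (lt0r_neq0 pi0)); rewrite mulrCA mulrA peak_sqr mulfV// gt_eqF.
      by rewrite -mulrA invfM.
    by field; rewrite !gt_eqF.
  have mux : 0 < `|lam| * x by rewrite mulr_gt0.
  have fE : skew_normal_pdf lam x =
      2 * std_normal_pdf x * std_normal_cdf (- (`|lam| * x)).
    by rewrite /skew_normal_pdf ltr0_norm// mulNr opprK.
  have /andP := std_normal_upper_tail _ mux.
  rewrite -std_normal_cdfN !lee_fin => -[lo hi]; rewrite fE.
  apply/andP; split; last by rewrite qE ler_wpM2l.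
  (* Mills' inequality at [|lam| x] yields the factor [r x]; monotonicity then replaces it by
     [r t]. *)
  apply: (@le_trans _ _ (r x * q)).
    apply: ler_wpM2r => //; rewrite /r; apply: ler_wpM2l => //.
    have pos y : 0 < y -> 0 < 1 + 1 / 1 / (`|lam| * y) ^+ 2.
      by move=> y0; rewrite addr_gt0// divr_gt0// ?exprn_gt0 ?mulr_gt0.
    rewrite lef_pV2 ?posrE ?pos// lerD2l; apply: ler_wpM2l => //.
    rewrite lef_pV2 ?posrE ?exprn_gt0 ?mulr_gt0//.
    rewrite lerXn2r ?nnegrE ?mulr_ge0 ?(ltW t0) ?(ltW x0)//.
    by rewrite ler_pM2l// ltW.
  by rewrite qE mulrCA; apply: ler_wpM2l.
Unshelve. all: by end_near. Qed.

End skew_normal_tail.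

(** * Distribution of the sample maximum and its Gumbel limit *)

Lemma sample_max_cdf (d : measure_display) (T : measurableType d) (R : realType)
    (P : probability T R) (X : nat -> {RV P >-> R}) (q t : R) (n : nat) :
  mutually_independent X ->
  (forall i, P (X i @^-1` `]-oo, t]) = q%:E) -> (0 < n)%N ->
  P [set w | sample_max X n w <= t] = (q ^+ n)%:E.
Proof.
move=> indep Xq n0; pose J := [fset i in iota 0 n]%fset.
have inJ i : (i \in J) = (i < n)%N by rewrite !inE mem_iota add0n.
have -> : [set w | sample_max X n w <= t] =
    \bigcap_(i in [set` J]) (X i @^-1` `]-oo, t]).
  apply/seteqP; split => w /=.
    move/bigmax_leP => [_ Xw] i /=; rewrite inJ => ilt.
    by rewrite in_itv/=; exact: (Xw (Ordinal ilt)).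
  move=> Xw; apply/bigmax_leP; split.
    (* The default value [X 0] of the maximum must also be at most [t]; since [n > 0], it is one of
       the sample variables. *)
    by have /= := Xw 0%N; rewrite inJ in_itv/=; exact.
  by move=> i _; have /= := Xw i; rewrite inJ in_itv/=; exact.
rewrite indep; last by move=> i _; exact: measurable_itv.
under eq_bigr do rewrite Xq.
rewrite prodEFin big_const_seq count_predT iter_mulr_1.
by rewrite card_fseq undup_id ?iota_uniq// size_iota.
Qed.

(** By independence the probability is [(1 - H(t n)) ^ n] at the level [t n = a n * x + b n], for
    [n > 0], and [n H(t n)] tends to [exp (- x)]. *)
Lemma sample_max_gumbel (d : measure_display) (T : measurableType d) (R : realType)
    (P : probability T R) (X : nat -> {RV P >-> R}) (H : R -> R)
    (K c : R) (m : nat) (a b : nat -> R) (x : R) :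
  0 < K -> 0 < c -> mutually_independent X ->
  (forall i t, P (X i @^-1` `]-oo, t]) = (1 - H t)%:E) ->
  H t / (K * gauss_kernel c m.+1 t) @[t --> +oo] --> (1 : R) ->
  (forall n, (0 < n)%N -> 0 < b n) ->
  (forall n, (0 < n)%N -> n%:R * (K * gauss_kernel c m.+1 (b n)) = 1) ->
  (forall n, (0 < n)%N -> a n = (c * b n)^-1) ->
  P [set w | sample_max X n w <= a n * x + b n] @[n --> \oo] --> (gumbel_cdf x)%:E.
Proof.
move=> K0 c0 indep XH Hg b0 bK aE.
have : ((1 - H ((c * b n)^-1 * x + b n)) ^+ n)%:E @[n --> \oo]
    --> (gumbel_cdf x)%:E.
  have h := cvg_onem_exprn _ _ (tail_location_cvg K c m b K0 c0 b0 bK H x Hg).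
  by apply: (cvg_comp _ EFin h).
apply: cvg_trans; apply: near_eq_cvg; near=> n.
have n0 : (0 < n)%N by near: n; exact: nbhs_infty_gt.
by rewrite aE// (sample_max_cdf _ _ _ _ _ (1 - H ((c * b n)^-1 * x + b n))).
Unshelve. all: by end_near. Qed.

(** * The skew-normal maximum, by the sign of [lam] *)

Theorem theorem2p1 (d : measure_display) (T : measurableType d) (R : realType)
    (P : probability T R) (lam : R) (lam_neq0 : lam != 0)
    (X : nat -> {RV P >-> R})
    (X_density : forall i : nat, has_density (X i) (skew_normal_pdf lam))
    (X_indep : mutually_independent X)
    (a b : nat -> R)
    (b_loc : forall n : nat, (0 < n)%N -> is_location lam n (b n))
    (a_scale : forall n : nat, (0 < n)%N -> a n = scale_of_location lam (b n)) :
  forall x : R,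
    P [set w | sample_max X n w <= a n * x + b n] @[n --> \oo]
      --> (gumbel_cdf x)%:E.
Proof.
(* The common survival function, read off [X 0]; the shared density makes it the same for every
   [X i]. *)
move=> x; pose H t := fine (P (X 0%N @^-1` `]t, +oo[)).
have mX i (A : set R) : measurable A -> measurable (X i @^-1` A).
  by move=> mA; rewrite -[X in measurable X]setTI; exact: measurable_funP.
have HE i t : P (X i @^-1` `]t, +oo[) = (H t)%:E.
  have -> : P (X i @^-1` `]t, +oo[) = P (X 0%N @^-1` `]t, +oo[).
    have mt : measurable (`]t, +oo[%classic : set R) by exact: measurable_itv.
    by have := X_density i _ mt; rewrite -(X_density 0%N _ mt).
  by rewrite /H fineK// fin_num_measure//; apply: mX; exact: measurable_itv.
have H_density t : 0 < t -> (\int[lebesgue_measure]_(x in `]t, +oo[)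
    (skew_normal_pdf lam x)%:E = (H t)%:E)%E.
  move=> _; rewrite -(HE 0%N).
  by have := X_density 0%N _ (measurable_itv `]t, +oo[); move=> <-.
have H_cdf i t : P (X i @^-1` `]-oo, t]) = (1 - H t)%:E.
  rewrite EFinB -(HE i) -probability_setC; last by apply: mX; exact: measurable_itv.
  by rewrite preimage_setC setCitvr.
have p0 := @peak_gt0 R; have pi0 := pi_gt0 R.
have [lam_gt0|lam_le0] := ltP 0 lam.
- have s0 : 0 < Num.sqrt (pi / 2 : R) by rewrite sqrtr_gt0 divr_gt0.
  have bE n : (0 < n)%N -> Num.sqrt (pi / 2) * b n * expR (b n ^+ 2 / 2) = n%:R.
    by move=> /b_loc; rewrite /is_location lam_gt0.
  (* For [lam > 0] positivity comes from the equation itself: a product with positive cofactors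
     equals [n > 0]. *)
  have b0 n : (0 < n)%N -> 0 < b n.
    move=> n0; have : 0 < n%:R :> R by rewrite ltr0n.
    by rewrite -bE// pmulr_lgt0 ?expR_gt0// pmulr_rgt0.
  (* The last argument is the kernel exponent minus one: 0 here, and 1 in the case [lam < 0]. *)
  apply: (sample_max_gumbel _ _ _ _ _ H (2 * normal_peak 1) 1 0) => //.
  + by rewrite mulr_gt0.
  + exact: (skew_normal_tail_pos lam).
  + move=> n n0; rewrite -bE// /gauss_kernel expr1.
    rewrite (_ : 1 / 2 * b n ^+ 2 = b n ^+ 2 / 2); last by field.
    rewrite expRN -[RHS]sqrt_pi_half_peak; field.
    by rewrite !gt_eqF ?b0 ?expR_gt0.
  + by move=> n n0; rewrite a_scale// /scale_of_location lam_gt0 mul1r.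
- have lam_lt0 : lam < 0 by rewrite lt_neqAle lam_neq0.
  have c0 : 0 < 1 + lam ^+ 2 by rewrite ltr_wpDr// sqr_ge0.
  have mu0 : 0 < `|lam| by rewrite normr_gt0.
  have bE n : (0 < n)%N -> 0 < b n /\ pi * `|lam| * (1 + lam ^+ 2) * b n ^+ 2 *
      expR ((1 + lam ^+ 2) * b n ^+ 2 / 2) = n%:R.
    by move=> /b_loc; rewrite /is_location ltNge lam_le0.
  apply: (sample_max_gumbel _ _ _ _ _ H (pi * `|lam| * (1 + lam ^+ 2))^-1
    (1 + lam ^+ 2) 1) => //.
  + by rewrite invr_gt0 !mulr_gt0.
  + exact: (skew_normal_tail_neg lam).
  + by move=> n /bE[].
  + move=> n /bE[b0 <-]; rewrite /gauss_kernel.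
    rewrite (_ : (1 + lam ^+ 2) / 2 * b n ^+ 2 = (1 + lam ^+ 2) * b n ^+ 2 / 2).
      rewrite expRN; set A := pi * _ * _; set E := expR _.
      have A0 : A != 0 by rewrite gt_eqF// !mulr_gt0.
      have E0 : E != 0 by rewrite gt_eqF// expR_gt0.
      by clearbody A E; field; rewrite A0 E0 gt_eqF.
    by field.
  + move=> n n0; rewrite a_scale// /scale_of_location ltNge lam_le0/=.
    by rewrite invfM.
Qed.
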